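(* Let $n\ge 1$, $N=\{1,\dots,n\}$, $0\le t_0<t_1$, $x_0\in\mathbb{R}^m$, and for each $k\in N$ let $U_k\subset C([t_0,t_1];\mathbb{R}^{m_k})$ be a set of admissible controls as described in the context (nonempty, closed, uniformly bounded by $M_k$, equicontinuous), which is in addition convex. Let $f\in Y$. For each $i\in N$ let $\boldsymbol{J}_i=(J^i_1,\dots,J^i_{d_i}):U_1\times\dots\times U_n\to\mathcal{I}(\mathbb{R})^{d_i}$ be the payoff $$\boldsymbol{J}_i(u_1,\dots,u_n)=\boldsymbol{\psi}_i(x(t_1))+\int_{t_0}^{t_1}\boldsymbol{L}_i(t,x(t),u_1(t),\dots,u_n(t))\,\mathrm{d}t,$$ where $x$ is the state generated by $(u_1,\dots,u_n)$. Suppose that for each $i\in N$ there exists $k_i\in\{1,\dots,d_i\}$ such that (i) $J^i_{k_i}:U_1\times\dots\times U_n\to\mathcal{I}(\mathbb{R})$ is continuous, and (ii) for each $u_{-i}\in U_{-i}=\prod_{j\ne i}U_j$, the map $u_i\mapsto J^i_{k_i}(u_i,u_{-i})$ is generalized $\mathcal{I}(\mathbb{R}_+)$-quasi-concave on $U_i$. Then the multi-objective interval differential game has at least one open-loop Pareto-Nash equilibrium, i.e. there exists $(u_1^*,\dots,u_n^* )\in U_1\times\dots\times U_n$ such that for every $i\in N$ and every $u_i\in U_i$, $\boldsymbol{J}_i(u_i^*,u_{-i}^* )\nprec\boldsymbol{J}_i(u_i,u_{-i}^* )$.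
   Context: Interval arithmetic: $\mathcal{I}(\mathbb{R})$ is the set of compact intervals $[\underline a,\overline a]$, $\mathcal{I}(\mathbb{R})^d$ the set of $d$-tuples of such intervals; addition is $[a,b]+[c,d]=[a+c,b+d]$ componentwise, and $\lambda[a,b]=[\min(\lambda a,\lambda b),\max(\lambda a,\lambda b)]$. The gH-difference is $[\underline a,\overline a]\ominus_{gH}[\underline b,\overline b]=[\min\{\underline a-\underline b,\overline a-\overline b\},\max\{\underline a-\underline b,\overline a-\overline b\}]$, taken componentwise for interval vectors. $\mathcal{I}(\mathbb{R}_+)$ is the set of compact intervals contained in $[0,+\infty)$, $\mathcal{I}(\mathbb{R}_+)^d$ the $d$-tuples of them, and $\mathrm{int}\,\mathcal{I}(\mathbb{R}_+)^d$ its interior (the $d$-tuples of compact intervals each contained in $(0,+\infty)$). For $\boldsymbol A,\boldsymbol B\in\mathcal{I}(\mathbb{R})^d$, $\boldsymbol B\prec\boldsymbol A$ means $\boldsymbol A\ominus_{gH}\boldsymbol B\in\mathrm{int}\,\mathcal{I}(\mathbb{R}_+)^d$; $\boldsymbol B\nprec\boldsymbol A$ means this fails. An interval-valued function $F$ on a Hausdorff space $\mathcal X$ is continuous if for each $x$ and $\epsilon>0$ there is an open neighbourhood $o(x)$ with $F(x')\ominus_{gH}F(x)\subset(-\epsilon,\epsilon)$ for all $x'\in o(x)$. For $\mathcal K$ a nonempty convex set, $F:\mathcal K\to\mathcal I(\mathbb R)$ is generalized $\mathcal{I}(\mathbb{R}_+)$-quasi-concave if for all $x_1,x_2\in\mathcal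 K$, $\boldsymbol A\in\mathcal I(\mathbb R)$, $\lambda\in[0,1]$: whenever $\boldsymbol A\ominus_{gH}F(x_j)\notin\mathrm{int}\,\mathcal I(\mathbb R_+)$ for $j=1,2$, then $\boldsymbol A\ominus_{gH}F(\lambda x_1+(1-\lambda)x_2)\notin\mathrm{int}\,\mathcal I(\mathbb R_+)$. Setting: $C([t_0,t_1];\mathbb{R}^{m_k})$ carries the norm $\|u\|=\max_{t}\|u(t)\|$; $U_1\times\dots\times U_n$ carries the product topology. Each $U_k$ is nonempty and closed, there is $M_k>0$ with $\|u_k\|\le M_k$ for all $u_k\in U_k$, and $U_k$ is equicontinuous (hence compact). $D=\{(t,x,u_1,\dots,u_n): t\in[t_0,t_1],x\in\mathbb R^m,\|u_k\|\le M_k\}$, and $Y$ is the set of continuous $f:D\to\mathbb R^m$ for which there are $M,L>0$ with $\sup_D\|f\|\le M$ and $\|f(t,x_1,u)-f(t,x_2,u)\|\le L\|x_1-x_2\|$. For $f\in Y$ and $u_k\in U_k$, the state $x$ is the unique solution of $\dot x(t)=f(t,x(t),u_1(t),\dots,u_n(t))$, $x(t_0)=x_0$. Here $\boldsymbol\psi_i:\mathbb R^m\to\mathcal I(\mathbb R)^{d_i}$ and $\boldsymbol L_i:[t_0,t_1]\times\mathbb R^m\times\mathbb R^{m_1}\times\dots\times\mathbb R^{m_n}\to\mathcal I(\mathbb R)^{d_i}$; the integral of an interval-vector-valued function is the Aumann integral, which for integrable bounded functions equals the vector of intervals $[\int\underline f_j,\int\overline f_j]$ of integrals of the endpoint functions.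 *)

(* Defs.v *)
From HB Require Import structures.
From mathcomp Require Import all_boot all_order all_algebra.
From mathcomp Require Import all_classical all_reals all_analysis.
From Stdlib Require Import ClassicalEpsilon.

Set Implicit Arguments.
Unset Strict Implicit.
Unset Printing Implicit Defensive.

Import Order.TTheory GRing.Theory Num.Theory.
Import numFieldNormedType.Exports.
Local Open Scope classical_set_scope.
Local Open Scope ring_scope.

(* Interval arithmetic.  A compact interval [lo,hi] is represented   *)
(* by the pair (lo,hi); it is well formed when lo <= hi.             *)
Section Intervals.
Variable R : realType.

Definition itv := (R * R)%type.

Definition is_itv (A : itv) : Prop := A.1 <= A.2.

Definition itv_add (A B : itv) : itv := (A.1 + B.1, A.2 + B.2).

Definition gH (A B : itv) : itv :=
  (Num.min (A.1 - B.1) (A.2 - B.2), Num.max (A.1 - B.1) (A.2 - B.2)).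

Definition in_int_Rplus (A : itv) : Prop :=
  forall r : R, A.1 <= r <= A.2 -> 0 < r.

Definition itv_vec (d : nat) := 'I_d -> itv.

Definition itv_prec (d : nat) (B A : itv_vec d) : Prop :=
  forall j : 'I_d, in_int_Rplus (gH (A j) (B j)).

Definition itv_within (eps : R) (A B : itv) : Prop :=
  forall r : R, (gH A B).1 <= r <= (gH A B).2 -> - eps < r < eps.

Definition gen_qconcave (V : lmodType R) (K : set V) (F : V -> itv) : Prop :=
  forall (x1 x2 : V) (A : itv) (lam : R),
    K x1 -> K x2 -> is_itv A -> 0 <= lam <= 1 ->
    ~ in_int_Rplus (gH A (F x1)) -> ~ in_int_Rplus (gH A (F x2)) ->
    ~ in_int_Rplus (gH A (F (lam *: x1 + (1 - lam) *: x2))).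

End Intervals.

(* A control u_k in C([t0,t1];R^{m_k}) is represented by a function  *)
(* R -> 'rV_{m_k} that is continuous on [t0,t1]; only its values on  *)
(* [t0,t1] matter.  Norms on R^p are the library's norm on 'rV_p.    *)
Section Game.
Variable R : realType.

Definition ctrl (p : nat) := R -> 'rV[R]_p.

Definition is_Cfun (t0 t1 : R) (p : nat) (u : ctrl p) : Prop :=
  {within `[t0, t1], continuous u}.

Definition sup_dist (t0 t1 : R) (p : nat) (u v : ctrl p) : R :=
  sup [set `|u t - v t| | t in `[t0, t1]].

Definition closed_C (t0 t1 : R) (p : nat) (U : set (ctrl p)) : Prop :=
  forall v, is_Cfun t0 t1 v -> ~ U v ->
    exists2 e : R, 0 < e &
      forall w, is_Cfun t0 t1 w -> sup_dist t0 t1 w v < e -> ~ U w.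

Definition equicont (t0 t1 : R) (p : nat) (U : set (ctrl p)) : Prop :=
  forall t, t \in `[t0, t1] -> forall e : R, 0 < e ->
    exists2 del : R, 0 < del &
      forall u, U u -> forall s, s \in `[t0, t1] -> `|s - t| < del ->
        `|u s - u t| < e.

Definition convex_C (p : nat) (U : set (ctrl p)) : Prop :=
  forall u v, U u -> U v -> forall lam : R, 0 <= lam <= 1 ->
    U (lam *: u + (1 - lam) *: v).

Definition admissible (t0 t1 : R) (p : nat) (Mk : R) (U : set (ctrl p)) : Prop :=
  [/\ U !=set0,
      (forall u, U u -> is_Cfun t0 t1 u),
      closed_C t0 t1 U,
      0 < Mk /\ (forall u, U u -> forall t, t \in `[t0, t1] -> `|u t| <= Mk)
    & equicont t0 t1 U].

Variables (n m : nat) (mk : 'I_n -> nat).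

Definition ctrl_prof := forall k : 'I_n, ctrl (mk k).
Definition ctrl_val := forall k : 'I_n, 'rV[R]_(mk k).

Definition inD (t0 t1 : R) (M : 'I_n -> R) (t : R) (w : ctrl_val) : Prop :=
  t0 <= t <= t1 /\ forall k, `|w k| <= M k.

Definition in_Y (t0 t1 : R) (M : 'I_n -> R)
    (f : R -> 'rV[R]_m -> ctrl_val -> 'rV[R]_m) : Prop :=
  [/\
      (forall t x w, inD t0 t1 M t w -> forall e : R, 0 < e ->
         exists2 del : R, 0 < del &
           forall t' x' w', inD t0 t1 M t' w' ->
             `|t' - t| < del -> `|x' - x| < del ->
             (forall k, `|w' k - w k| < del) ->
             `|f t' x' w' - f t x w| < e),
      (exists2 Mf : R, 0 < Mf &
         forall t x w, inD t0 t1 M t w -> `|f t x w| <= Mf)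
    &
      (exists2 Lf : R, 0 < Lf &
         forall t x1 x2 w, inD t0 t1 M t w ->
           `|f t x1 w - f t x2 w| <= Lf * `|x1 - x2|)].

Definition prof_at (u : ctrl_prof) (t : R) : ctrl_val := fun k => u k t.

Definition is_state (t0 t1 : R) (x0 : 'rV[R]_m)
    (f : R -> 'rV[R]_m -> ctrl_val -> 'rV[R]_m) (u : ctrl_prof)
    (x : R -> 'rV[R]_m) : Prop :=
  [/\ x t0 = x0,
      {within `[t0, t1], continuous x}
    & forall t, t \in `]t0, t1[ -> is_derive t 1 x (f t (x t) (prof_at u t))].

(* the (unique) state generated by u *)
Definition state (t0 t1 : R) (x0 : 'rV[R]_m)
    (f : R -> 'rV[R]_m -> ctrl_val -> 'rV[R]_m) (u : ctrl_prof) : R -> 'rV[R]_m :=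
  epsilon (inhabits (fun _ => 0)) (is_state t0 t1 x0 f u).

Definition payoff (t0 t1 : R) (x0 : 'rV[R]_m)
    (f : R -> 'rV[R]_m -> ctrl_val -> 'rV[R]_m) (d : nat)
    (psi : 'rV[R]_m -> itv_vec R d)
    (L : R -> 'rV[R]_m -> ctrl_val -> itv_vec R d)
    (u : ctrl_prof) : itv_vec R d :=
  let x := state t0 t1 x0 f u in
  fun j => itv_add (psi (x t1) j)
    (Rintegral (@lebesgue_measure R) `[t0, t1] (fun t => (L t (x t) (prof_at u t) j).1),
     Rintegral (@lebesgue_measure R) `[t0, t1] (fun t => (L t (x t) (prof_at u t) j).2)).

Definition in_prod (U : forall k : 'I_n, set (ctrl (mk k))) (u : ctrl_prof) : Prop :=
  forall k, U k (u k).

Definition itv_cont_on_prod (t0 t1 : R) (U : forall k : 'I_n, set (ctrl (mk k)))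
    (F : ctrl_prof -> itv R) : Prop :=
  forall u, in_prod U u -> forall e : R, 0 < e ->
    exists2 del : R, 0 < del &
      forall u', in_prod U u' ->
        (forall k, sup_dist t0 t1 (u' k) (u k) < del) ->
        itv_within e (F u') (F u).

Definition upd (u : ctrl_prof) (i : 'I_n) (v : ctrl (mk i)) : ctrl_prof :=
  dfwith u i v.

End Game.

(* Main.v *)
Require Import Defs.
From HB Require Import structures.
From mathcomp Require Import all_boot all_order all_algebra.
From mathcomp Require Import all_classical all_reals all_analysis.
From mathcomp Require Import zify ring lra.
Import Order.TTheory GRing.Theory Num.Theory.
Import numFieldNormedType.Exports.
Local Open Scope classical_set_scope.
Local Open Scope ring_scope.

(** Put [H i u] for the larger endpoint of the payoff component [k_i].  It is
    continuous, and it is quasi-concave in the [i]-th control: apply (ii) to the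
    degenerate intervals [[c, c]].  If [u] is a Nash equilibrium for the scalar
    payoffs [H i], no deviation can raise both endpoints of component [k_i], so
    [u] is a Pareto-Nash equilibrium; the dynamics play no further role.

    A scalar equilibrium exists because the closed conditions
    "[v] does not improve [H i] at [u]" have the finite intersection property
    over the compact set of control profiles.  For finitely many deviations one
    looks for an equilibrium in the product of the polytopes they span: at a
    fixed point of Nash's map, quasi-concavity forbids every control in the
    support from being a strict improvement.

    Brouwer's theorem on a simplex follows from Scarf's combinatorial lemma on
    finite sets with several linear orders, which plays the role of Sperner's
    lemma without any triangulation. *)

Set Implicit Arguments.
Unset Strict Implicit.
Unset Printing Implicit Defensive.

(** * Primitive sets and their extensions *)

Section PrimitiveSets.
Import mathcomp.boot.fintype mathcomp.boot.finset.
Local Open Scope nat_scope.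
Local Open Scope set_scope.

(** The cardinalities allow one collision only: [f] identifies a single pair in [A], and those two
    points are the removable ones. *)
Lemma card_removable_eq2 (aT rT : finType) (f : aT -> rT) (A : {set aT}) :
  #|A| = #|f @: A|.+1 -> #|[set a in A | f @: (A :\ a) == f @: A]| = 2.
Proof.
move=> cA.
have : ~~ [forall a in A, forall b in A, (f a == f b) ==> (a == b)].
  apply/negP => /forall_inP injf.
  suff : #|f @: A| = #|A| by move=> e; rewrite e in cA; lia.
  apply: card_in_imset => a b aA bA /eqP fab.
  by apply/eqP; move/forall_inP: (injf a aA) => /(_ b bA); rewrite fab.
rewrite negb_forall_in => /exists_inP[a aA].
rewrite negb_forall_in => /exists_inP[b bA].
rewrite negb_imply => /andP[/eqP fab ab].
have rem x y : x \in A -> y \in A -> x != y -> f x = f y ->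
    f @: (A :\ x) = f @: A.
  move=> xA yA xy fxy; apply/eqP; rewrite eqEsubset imsetS ?subD1set //=.
  apply/subsetP => _ /imsetP[z zA ->].
  have [->|zx] := eqVneq z x.
    by rewrite fxy imset_f // !inE eq_sym xy.
  by rewrite imset_f // !inE zx.
have ra := rem a b aA bA ab fab.
have ba : b != a by rewrite eq_sym.
have rb := rem b a bA aA ba (esym fab).
have injA : {in A :\ a &, injective f}.
  apply/imset_injP; rewrite ra; move: (cardsD1 a A); rewrite aA cA; lia.
suff -> : [set a in A | f @: (A :\ a) == f @: A] = [set a; b].
  by rewrite cards2 ab.
apply/setP => c; rewrite !inE; apply/andP/idP; last first.
  by move=> /orP[]/eqP->; split=> //; rewrite ?ra ?rb.
move=> [cA' /eqP rc]; apply/negP => /negP; rewrite negb_or => /andP[ca cb].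
have : f c \in f @: (A :\ c) by rewrite rc imset_f.
move=> /imsetP[d]; rewrite !inE => /andP[dc dA] fcd.
have [da|da] := eqVneq d a.
  move: cb; rewrite (injA c b) ?eqxx // ?inE ?ca ?cA' ?bA ?(eq_sym b) ?ab //.
  by rewrite fcd da.
by move: dc; rewrite (injA c d) ?eqxx // !inE ?ca ?cA' ?da ?dA.
Qed.

Variables (V I : finType) (key : I -> V -> nat).
Hypothesis key_inj : forall i, injective (key i).

(** Scarf's primitive sets: no point exceeds the minimum of [P] in all orders at once. *)
Definition primitive (P : {set V}) :=
  [forall y, exists i, forall x in P, key i y <= key i x].

Lemma primitiveP {P : {set V}} :
  reflect (forall y, exists i, {in P, forall x, key i y <= key i x})
          (primitive P).
Proof.
apply: (iffP forallP) => h y; have := h y.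
  by move=> /existsP[i /forall_inP hi]; exists i.
by move=> [i hi]; apply/existsP; exists i; apply/forall_inP.
Qed.

Lemma primitiveS (P Q : {set V}) : Q \subset P -> primitive P -> primitive Q.
Proof.
move=> /subsetP QP /primitiveP h; apply/primitiveP => y.
by have [i hi] := h y; exists i => x /QP; apply: hi.
Qed.

Definition key_min (x0 : V) (P : {set V}) i := [arg min_(x < x0 in P) key i x].

Lemma key_min_in x0 (P : {set V}) i : x0 \in P -> key_min x0 P i \in P.
Proof. by move=> x0P; rewrite /key_min; case: arg_minnP. Qed.

Lemma key_min_le x0 (P : {set V}) i x :
  x0 \in P -> x \in P -> key i (key_min x0 P i) <= key i x.
Proof. by move=> x0P xP; rewrite /key_min; case: arg_minnP => // ? _; apply. Qed.

Lemma key_min_eq x0 (P : {set V}) i x : x0 \in P -> x \in P ->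
  {in P, forall y, key i x <= key i y} -> key_min x0 P i = x.
Proof.
move=> x0P xP h; apply: (@key_inj i); apply/eqP.
by rewrite eqn_leq key_min_le // h // key_min_in.
Qed.

Lemma key_min_onto x0 (P : {set V}) : x0 \in P -> primitive P ->
  key_min x0 P @: setT = P.
Proof.
move=> x0P /primitiveP dP; apply/eqP; rewrite eqEsubset; apply/andP; split.
  by apply/subsetP => _ /imsetP[i _ ->]; apply: key_min_in.
apply/subsetP => x xP; have [i hi] := dP x.
by rewrite -(key_min_eq x0P xP hi) imset_f.
Qed.

Lemma card_primitive_extensions (Q : {set V}) (q0 : V) : q0 \in Q ->
  #|I| = #|Q|.+1 -> primitive Q ->
  (forall i, exists s, forall j, j != i -> key j q0 < key j s) ->
  #|[set x | (x \notin Q) && primitive (x |: Q)]| = 2.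
Proof.
move=> q0Q cI prQ slack.
pose mn := key_min q0 Q.
have mnQ : mn @: setT = Q by apply: key_min_onto.
pose I2 := [set i in [set: I] | mn @: (setT :\ i) == mn @: setT].
have cI2 : #|I2| = 2 by apply: card_removable_eq2; rewrite mnQ cardsT.
have mn_le i q : q \in Q -> key i (mn i) <= key i q by apply: key_min_le.
(* Candidates for the new point that becomes minimal in order [i]; the slack hypothesis makes [Z i]
   nonempty. *)
pose Z i := [pred y | [forall j, (j != i) ==> (key j (mn j) < key j y)]].
have ZP i y : reflect (forall j, j != i -> key j (mn j) < key j y) (y \in Z i).
  by apply: (iffP forallP) => h j; [move/implyP: (h j)|apply/implyP; exact: h].
have Zn i : exists s, s \in Z i.
  have [s hs] := slack i; exists s; apply/ZP => j ji.
  by apply: leq_ltn_trans (hs j ji); apply: mn_le.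
pose g i := [arg max_(y > xchoose (Zn i) in Z i) key i y].
have gZ i : g i \in Z i by rewrite /g; case: arg_maxnP => //; exact: xchooseP.
have gmax i y : y \in Z i -> key i y <= key i (g i).
  by rewrite /g; case: arg_maxnP => [|z _ + yZ]; [exact: xchooseP|exact].
(* Primitivity of [Q] at [g i] cannot be witnessed by an order other than [i], since there [g i] is
   above the minimum. *)
have gQ i q : q \in Q -> key i (g i) <= key i q.
  move=> qQ; have [i' hi'] := primitiveP prQ (g i).
  have [e|ne] := eqVneq i' i; first by move: hi'; rewrite e; apply.
  have := ZP _ _ (gZ i) i' ne; rewrite ltnNge hi' //.
  by apply: key_min_in.
have mnP i : mn i \in Q by apply: key_min_in.
rewrite -cI2 -(@card_in_imset _ _ g I2); last first.
  move=> i i' _ _ gii'; apply/eqP/negP => /negP ne.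
  have := ZP _ _ (gZ i) i'; rewrite eq_sym ne => /(_ isT).
  by rewrite gii' ltnNge gQ.
congr #|pred_of_set _|; apply/setP => x; rewrite inE; apply/andP/imsetP.
  move=> [xQ prx]; have xx : x \in x |: Q by rewrite setU11.
  have honto := key_min_onto xx prx.
  pose h := key_min x (x |: Q).
  (* There are as many points in [x |: Q] as orders, so [x] is minimal in a single order [i] and the
     other minima are those of [Q]. *)
  have hinj : injective h.
    suff : {in setT &, injective h} by move=> hh i j; apply: hh.
    by apply/imset_injP; rewrite honto cardsT cardsU1 xQ cI.
  have /imsetP[i _ xhi] : x \in h @: setT by rewrite honto.
  have hQ j : j != i -> h j \in Q.
    move=> ji; have : h j \in x |: Q by apply: key_min_in.
    rewrite !inE => /orP[/eqP hjx|//]; move: ji.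
    by rewrite (hinj j i) ?eqxx // hjx.
  have hmn j : j != i -> h j = mn j.
    move=> ji; symmetry; apply: key_min_eq => //; first exact: hQ.
    by move=> y yQ; apply: key_min_le => //; rewrite inE yQ orbT.
  have xZ : x \in Z i.
    apply/ZP => j ji; rewrite ltn_neqAle -hmn //; apply/andP; split.
      by apply/negP => /eqP/key_inj hj; move: xQ; rewrite -hj hQ.
    exact: key_min_le.
  exists i; last first.
    apply: (@key_inj i); apply/eqP; rewrite eqn_leq gmax //=.
    have [i' hi'] := primitiveP prx (g i).
    have [e|ne] := eqVneq i' i.
      by move: hi'; rewrite e; apply; rewrite setU11.
    have := ZP _ _ (gZ i) i' ne; rewrite ltnNge hi' //.
    by rewrite inE mnP orbT.
  rewrite inE in_setT mnQ eqEsubset /=; apply/andP; split.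
    by apply/subsetP => _ /imsetP[j _ ->]; exact: mnP.
  apply/subsetP => q qQ.
  have /imsetP[j _ qhj] : q \in h @: setT by rewrite honto inE qQ orbT.
  have ji : j != i by apply/eqP => e; move: xQ; rewrite xhi -e -qhj qQ.
  by rewrite qhj hmn // imset_f // !inE ji.
move=> [i]; rewrite !inE => /eqP hi ->; split.
  apply/negP; rewrite -mnQ -hi => /imsetP[j]; rewrite !inE andbT => ji gj.
  by have := ZP _ _ (gZ i) j ji; rewrite gj ltnn.
apply/primitiveP => y.
have [yZ|] := boolP (y \in Z i).
  exists i => z; rewrite !inE => /orP[/eqP->|zQ]; first exact: gmax.
  exact: leq_trans (gmax _ _ yZ) (gQ _ _ zQ).
rewrite negb_forall => /existsP[j]; rewrite negb_imply -leqNgt => /andP[ji yj].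
exists j => z; rewrite !inE => /orP[/eqP->|zQ]; apply: (leq_trans yj).
  exact: ltnW (ZP _ _ (gZ i) j ji).
exact: mn_le.
Qed.

End PrimitiveSets.

(** * Scarf's combinatorial lemma *)

Section Scarf.
Import mathcomp.boot.fintype mathcomp.boot.finset.
Local Open Scope nat_scope.
Local Open Scope set_scope.

Variables (T I : finType) (key : I -> T -> nat) (c : T -> I).
Hypothesis key_inj : forall i, injective (key i).

(* The slack point [inr j] lies below all of [T] for the order [j] and above
   all of [T] for every other order. *)
Let skey (i : I) (v : T + I) : nat :=
  match v with
  | inl t => (key i t).+1
  | inr j => if j == i then 0 else (\max_t key i t + enum_rank j).+2
  end.

Let scol (v : T + I) : I := match v with inl t => c t | inr j => j end.

Let skey_slack i j t : j != i -> skey i (inl t) < skey i (inr j).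
Proof.
move=> ji /=; rewrite (negbTE ji) !ltnS.
by apply: leq_trans (leq_addr _ _); apply: leq_bigmax.
Qed.

Let skey_inj i : injective (skey i).
Proof.
case=> [t|j] [t'|j'] /=.
- by move=> [/key_inj ->].
- have [<-|ne] := eqVneq j' i; rewrite ?eqxx //= => e.
  by have := @skey_slack i j' t ne; rewrite /= e (negbTE ne) ltnn.
- have [<-|ne] := eqVneq j i; rewrite ?eqxx //= => e.
  by have := @skey_slack i j t' ne; rewrite /= (negbTE ne) e ltnn.
- have [->|ne] := eqVneq j i; have [->|ne'] := eqVneq j' i; rewrite ?eqxx //=.
  by move=> [/addnI/ord_inj/enum_rank_inj ->].
Qed.

(** Parity count of pairs of a room and one of its doors. A room lacking a colour has no door or
    two; a door lies in no room or two, except the door [Q0] of slack points, which lies in one.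
    Hence some room carries all colours. *)
Lemma scarf (t0 : T) : 1 < #|I| ->
  exists (s : {set T}) (C : {set I}),
    {in C, forall i, exists2 t, t \in s & c t = i} /\
    (forall y, exists2 i, i \in C & {in s, forall x, key i y <= key i x}).
Proof.
move=> cI; pose i0 := c t0.
pose room (P : {set T + I}) := (#|P| == #|I|) && primitive skey P.
pose door (Q : {set T + I}) :=
  (#|Q|.+1 == #|I|) && (scol @: Q == [set~ i0]).
have cI0 : #|[set~ i0]|.+1 = #|I| by rewrite cardsC1; lia.
suff [P /andP[_ /primitiveP prP] colP] :
    exists2 P, room P & scol @: P = [set: I].
  (* A colour whose slack point is outside [P] is carried by a point of [T]. An order whose slack
     point is in [P] cannot witness primitivity at a point of [T], since that slack point is lowest
     there. *)
  exists [set t | inl t \in P], [set i | inr i \notin P]; split.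
    move=> i; rewrite inE => iP.
    have /imsetP[[t|j] vP iv] : i \in scol @: P by rewrite colP inE.
      by exists t; rewrite ?inE.
    by move: iP; rewrite iv vP.
  move=> y; have [i hi] := prP (inl y); exists i.
    by rewrite inE; apply/negP => /hi /=; rewrite eqxx.
  by move=> x; rewrite inE => /hi.
apply: contrapT => nocol.
pose face (P : {set T + I}) (x : T + I) := [&& x \in P, room P & door (P :\ x)].
pose S := \sum_(P : {set T + I}) \sum_(x | face P x) 1.
have evenS : 2 %| S.
  apply: dvdn_sum => P _; rewrite sum1dep_card.
  have [/existsP[x0 /and3P[x0P roomP doorx0]]|nd] :=
      boolP [exists x, face P x]; last first.
    rewrite (_ : [set x | _] = set0) ?cards0 //; apply/setP => x.
    rewrite !inE; apply/negP => fx; by move/existsP: nd; apply; exists x.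
  have /andP[/eqP cP _] := roomP.
  have colP : scol @: P = [set~ i0].
    have sub : [set~ i0] \subset scol @: P.
      by case/andP: doorx0 => _ /eqP <-; apply: imsetS; apply: subD1set.
    apply/eqP; rewrite eq_sym eqEcard sub /=.
    have [//|h] := leqP #|scol @: P| #|[set~ i0]|.
    case: nocol; exists P => //; apply/eqP; rewrite eqEcard subsetT cardsT /=.
    by rewrite -cI0.
  have c2 := @card_removable_eq2 _ _ scol P.
  rewrite colP cI0 cP in c2.
  rewrite (_ : [set x | _] = [set a in P | scol @: (P :\ a) == [set~ i0]]) ?c2 //.
  apply/setP => x; rewrite !inE /face roomP /door /=.
  by have [xP|//] := boolP (x \in P); rewrite -cP (cardsD1 x P) xP eqxx.
have SE : S = \sum_(Q | door Q) #|[set x | (x \notin Q) && room (x |: Q)]|.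
  rewrite /S (exchange_big_dep predT) //=.
  under [RHS]eq_bigr do rewrite -sum1dep_card.
  rewrite [RHS](exchange_big_dep predT) //=; apply: eq_bigr => x _.
  rewrite (reindex_onto (fun Q => x |: Q) (fun P => P :\ x)) /=; last first.
    by move=> P /and3P[xP _ _]; rewrite setD1K.
  apply: eq_bigl => Q; rewrite /face setU11 /=.
  have [xQ|xQ] := boolP (x \in Q).
    rewrite !andbF; apply/negP => /andP[_ /eqP e].
    by move: xQ; rewrite -e !inE eqxx.
  by rewrite setU1K // eqxx andbT andbC.
pose Q0 : {set T + I} := inr @: [set~ i0].
have colQ0 : scol @: Q0 = [set~ i0].
  by rewrite -imset_comp (eq_imset (g := id)) ?imset_id.
have doorQ0 : door Q0.
  by rewrite /door colQ0 card_imset ?cI0 ?eqxx // => ? ? [].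
have inQ0 j : (inr j \in Q0) = (j != i0).
  apply/imsetP/idP => [[j' + [->]]|ji]; first by rewrite !inE.
  by exists j; rewrite // !inE.
have tQ0 t : (inl t \in Q0) = false by apply/imsetP => -[].
(* The only room on [Q0] adds the top point of [T] in order [i0]: every other order has its lowest
   point, a slack point, in [Q0]. *)
have oneQ0 : #|[set x | (x \notin Q0) && room (x |: Q0)]| = 1.
  pose tm := [arg max_(t > t0) key i0 t].
  have tmP t : key i0 t <= key i0 tm.
    by rewrite /tm; case: arg_maxnP => // ? _; apply.
  rewrite (_ : [set x | _] = [set inl tm]) ?cards1 //.
  apply/setP => x; rewrite !inE; apply/andP/eqP.
    case: x => [t|j]; last first.
      rewrite inQ0 => -[/negPn/eqP-> /andP[_ /primitiveP pr]].
      have [i hi] := pr (inl t0); have := hi (inr i).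
      rewrite !inE inQ0 /= eqxx ltn0 => h.
      suff: false by []; apply: h; by have [->|] := eqVneq i i0; rewrite ?eqxx ?orbT.
    rewrite tQ0 => -[_ /andP[_ /primitiveP pr]].
    have [i hi] := pr (inl tm).
    have ii0 : i = i0.
      apply/eqP/negPn/negP => ne; have := hi (inr i).
      by rewrite !inE inQ0 ne orbT /= eqxx ltn0 => /(_ isT).
    congr inl; apply: (@key_inj i0); apply/eqP; rewrite eqn_leq tmP /=.
    by have := hi (inl t); rewrite ii0 !inE eqxx => /(_ isT).
  move=> ->; rewrite tQ0; split=> //; rewrite /room cardsU1 tQ0.
  have /andP[/eqP <- _] := doorQ0; rewrite add1n eqxx /=.
  apply/primitiveP => -[t|j].
    exists i0 => -[t'|j]; rewrite !inE ?tQ0 ?inQ0 ?orbF.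
      by move=> /eqP[->]; rewrite /= ltnS.
    by move=> ji; apply: ltnW; apply: skey_slack; move: ji.
  by exists j => z _; rewrite /= eqxx.
have : ~~ (2 %| S).
  rewrite SE (bigD1 Q0) //= oneQ0 dvdn_addl //.
  apply: dvdn_sum => Q /andP[/andP[/eqP cQ /eqP colQ] QQ0].
  have [prQ|nprQ] := boolP (primitive skey Q); last first.
    rewrite (_ : [set x | _] = set0) ?cards0 //; apply/setP => x; rewrite !inE.
    apply/negP => /andP[_ /andP[_ /primitiveS h]].
    by move/negP: nprQ; apply; apply: h; apply: subsetUr.
  (* A door made of slack points only is determined by its colours, hence equals [Q0]. *)
  have [t tQ] : exists t, inl t \in Q.
    apply: contrapT => nt; move/negP: QQ0; apply.
    rewrite eqEcard; apply/andP; split; last first.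
      by have /andP[/eqP] := doorQ0; rewrite -cQ => -[->].
    apply/subsetP => -[t tQ|j jQ]; first by case: nt; exists t.
    have : scol (inr j) \in scol @: Q by apply: imset_f.
    by rewrite colQ inQ0 !inE.
  rewrite (_ : [set x | _] = [set x | (x \notin Q) && primitive skey (x |: Q)]).
    rewrite (card_primitive_extensions skey_inj tQ) // => i.
    by exists (inr i) => j ji; apply: skey_slack; rewrite eq_sym.
  apply/setP => x; rewrite !inE /room.
  by have [xQ|xQ] := boolP (x \in Q); rewrite // cardsU1 xQ add1n cQ eqxx.
by rewrite evenS.
Qed.

End Scarf.

(** * Labellings of the integer grid in a simplex *)

Section Grid.
Local Open Scope nat_scope.

(** Scarf's lemma for the coordinate orders. The minima [m] of the coordinates over [s] nearly
    exhaust [N] on [C]; so points of [s] stay within [#|I|] of [m] on [C] and have coordinates at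
    most [#|I|] elsewhere. *)
Lemma grid_labelling (I : finType) (N : nat) (L : I -> (I -> nat) -> Prop) :
  1 < #|I| ->
  (forall p, \sum_i p i = N -> exists i, L i p) ->
  exists2 p, \sum_i p i = N &
    forall i, p i <= #|I| \/
      exists q, [/\ \sum_i q i = N, L i q &
        forall l, p l <= q l + #|I| /\ q l <= p l + #|I|].
Proof.
move=> cI hL.
have arith1 (N' a b S1 S2 p : nat) :
  N' < a + S1 + b -> S1 <= S2 -> p + S2 <= N' -> p <= a + b by lia.
have arith2 (N' b S1 S2 p r : nat) :
  N' < S1 + b -> S2 + (p + r) = N' -> S1 <= S2 -> p <= b by lia.
have arith3 (a b p q : nat) : a <= p -> a <= q -> p <= a + b -> q <= a + b ->
  p <= q + b /\ q <= p + b by lia.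
pose T := {x : {ffun I -> 'I_N.+1} | \sum_i x i == N}.
pose pt (x : T) i : nat := val x i.
have pt_sum (x : T) : \sum_i pt x i = N by apply/eqP; exact: (valP x).
have ptP p : \sum_i p i = N -> exists x : T, pt x = p.
  move=> sp.
  have lep i : p i < N.+1 by rewrite ltnS -sp (bigD1 i) //= leq_addr.
  pose y : {ffun I -> 'I_N.+1} := [ffun i => Ordinal (lep i)].
  have h : \sum_i y i == N.
    by apply/eqP; rewrite -[RHS]sp; apply: eq_bigr => i _; rewrite ffunE.
  by exists (exist _ y h : T); apply/funext => i; rewrite /pt /= ffunE.
have [i0 _] : exists i : I, i \in I by apply/card_gt0P; apply: ltnW.
have sum1 (i : I) (n : nat) : \sum_j (if j == i then n else 0) = n.
  by rewrite -big_mkcond big_pred1_eq.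
have [t0 _] := ptP _ (sum1 i0 N).
have [c hc] := choice (fun x : T => hL _ (pt_sum x)).
pose key i (x : T) := pt x i * #|{: T}| + enum_rank x.
have key_lt i x y : pt x i < pt y i -> key i x < key i y.
  move=> xy; rewrite /key; apply: (@leq_trans ((pt x i).+1 * #|{: T}|)).
    by rewrite mulSn addnC ltn_add2r.
  by apply: leq_trans (leq_addr _ _); rewrite leq_mul2r xy orbT.
have key_inj i : injective (key i).
  move=> x y e; apply: enum_rank_inj; apply: val_inj => /=.
  have ex : pt x i = pt y i.
    by have [/key_lt|/key_lt|//] := ltngtP (pt x i) (pt y i); rewrite e ltnn.
  by move: e; rewrite /key ex => /addnI.
have [s [C [sC dom]]] := scarf c key_inj t0 cI.
have [iC iCC _] := dom t0.
have [x0 x0s _] := sC _ iCC.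
pose m i := pt [arg min_(x < x0 in s) pt x i] i.
have mle i x : x \in s -> m i <= pt x i.
  by move=> xs; rewrite /m; case: arg_minnP => // ? _; apply.
have min_in i : exists2 x, x \in s & pt x i = m i.
  by rewrite /m; case: arg_minnP => // x xs _; exists x.
have sumC : N < \sum_(i in C) (m i).+1.
  rewrite ltnNge; apply/negP => le.
  (* Otherwise raise [m] by one on [C] and put the remaining mass [r] on [iC]: this grid point
     exceeds the minimum of [s] in every order of [C]. *)
  pose r := N - \sum_(i in C) (m i).+1.
  pose p i := (if i \in C then (m i).+1 else 0) + (if i == iC then r else 0).
  have [|y yp] := ptP p.
    by rewrite big_split /= sum1 -big_mkcond /= subnKC.
  have [i iCm hi] := dom y.
  have [x xs xm] := min_in i.
  have := hi x xs; rewrite leqNgt => /negP; apply; apply: key_lt.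
  by rewrite xm yp /p iCm leq_addr.
have cC : \sum_(i in C) (m i).+1 <= \sum_(i in C) m i + #|I|.
  rewrite [leqLHS](eq_bigr (fun i => m i + 1)); last by move=> i _; rewrite addn1.
  by rewrite big_split /= sum1_card leq_add2l max_card.
have NC := leq_trans sumC cC.
have sle (x : T) : \sum_(i in C) pt x i <= N.
  by rewrite -(pt_sum x) [leqRHS](bigID (mem C)) leq_addr.
have in_le x i : x \in s -> i \in C -> pt x i <= m i + #|I|.
  move=> xs iC'; have := sle x; rewrite (bigD1 i) //=.
  have : \sum_(j in C | j != i) m j <= \sum_(j in C | j != i) pt x j.
    by apply: leq_sum => j _; apply: mle.
  by move: NC; rewrite (bigD1 i) //=; exact: arith1.
have out_le x i : x \in s -> i \notin C -> pt x i <= #|I|.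
  move=> xs iC'; have : \sum_(j in C) m j <= \sum_(j in C) pt x j.
    by apply: leq_sum => j _; apply: mle.
  have := pt_sum x; rewrite (bigID (mem C)) /= [X in _ + X](bigD1 i) //=.
  by move: NC; apply: arith2.
exists (pt x0) => // i; have [iC'|iC'] := boolP (i \in C); last first.
  by left; apply: out_le.
have [q qs cq] := sC i iC'.
right; exists (pt q); split => // [|l]; first by rewrite -cq; exact: hc.
have [lC|lC] := boolP (l \in C).
  by apply: arith3 (mle l _ x0s) (mle l _ qs) _ _; apply: in_le.
by apply: (@arith3 0); rewrite // out_le.
Qed.

End Grid.

(** * Limits along ultrafilters *)

Section UltraLimits.

(** The image of an ultrafilter is again one, so the cluster point supplied by compactness is a
    limit. *)
Lemma ultra_compact_cvg (X : Type) (G : set_system X) (UG : UltraFilter G)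
    (T : topologicalType) (K : set T) (g : X -> T) :
  compact K -> (\forall x \near G, K (g x)) -> exists l : T, g x @[x --> G] --> l.
Proof.
move=> cK GK; have PG : ProperFilter G := @ultra_proper _ _ UG.
have [l [_ cl]] := cK (g x @[x --> G]) _ GK.
exists l => V Vl.
have [//|nV] := in_ultra_setVsetC (g @^-1` V) UG.
by have [y [yV]] := cl (~` V) V nV Vl.
Qed.

Lemma cvg_finsum (R : numFieldType) (X : Type) (G : set_system X) {FG : Filter G}
    (I : finType) (P : pred I) (a : X -> I -> R) (z : I -> R) :
  (forall i, a x i @[x --> G] --> z i) ->
  \sum_(i | P i) a x i @[x --> G] --> \sum_(i | P i) z i.
Proof.
move=> h; elim: (index_enum I) => [|i s ih].
  rewrite big_nil (_ : (fun x => _) = cst 0); first exact: cvg_cst.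
  by apply/funext => x; rewrite big_nil.
rewrite big_cons (_ : (fun x => _) = fun x =>
  if P i then a x i + \sum_(j <- s | P j) a x j else \sum_(j <- s | P j) a x j).
  by case: (P i) => //; apply: cvgD.
by apply/funext => x; rewrite big_cons.
Qed.

Lemma cvg_ge0 (R : realFieldType) (X : Type) (G : set_system X)
    {PG : ProperFilter G} (a : X -> R) (z : R) :
  (forall x, 0 <= a x) -> a x @[x --> G] --> z -> 0 <= z.
Proof.
move=> a0 az; rewrite -(cvg_lim _ az) //; apply: limr_ge.
  by apply/cvg_ex; exists z.
by near=> x.
Unshelve. all: by end_near.
Qed.

End UltraLimits.

(** * Brouwer's fixed point theorem on a simplex *)

Section Brouwer.
Variables (R : realType) (I : finType).

Definition simplex : set (I -> R) :=
  [set x | (forall i, 0 <= x i) /\ \sum_i x i = 1].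

(** Tested along every proper filter on [nat], not only [\oo], because limits are later taken along
    an ultrafilter. *)
Definition filter_continuous_on (S : set (I -> R)) (g : (I -> R) -> R) :=
  forall (G : set_system nat), ProperFilter G -> forall (a : nat -> I -> R) z,
    S z -> (forall n, S (a n)) -> (forall i, a n i @[n --> G] --> z i) ->
    g (a n) @[n --> G] --> g z.

Lemma simplex_le1 x i : simplex x -> x i <= 1.
Proof.
move=> [x0 <-]; rewrite (bigD1 i) //= lerDl; exact: sumr_ge0.
Qed.

Lemma simplex_labelling (L : I -> (I -> R) -> Prop) (e : R) :
  (1 < #|I|)%N -> 0 < e -> (forall x, simplex x -> exists i, L i x) ->
  exists2 x, simplex x & forall i, x i <= e \/
    exists y, [/\ simplex y, L i y & forall l, `|x l - y l| <= e].
Proof.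
move=> cI e0 hL.
pose N := (Num.truncn (#|I|%:R / e)).+1.
have N0 : 0 < N%:R :> R by rewrite ltr0n.
have cN : #|I|%:R / N%:R <= e.
  rewrite ler_pdivrMr // mulrC -ler_pdivrMr //; apply: ltW.
  exact: truncnS_gt.
pose sc (p : I -> nat) i : R := (p i)%:R / N%:R.
have scP p : (\sum_i p i = N)%N -> simplex (sc p).
  move=> sp; split=> [i|]; first by rewrite divr_ge0 ?ler0n.
  by rewrite -mulr_suml -natr_sum sp divff ?gt_eqF.
have [p sp hp] := @grid_labelling I N (fun i p => L i (sc p)) cI
  (fun p sp => hL _ (scP _ sp)).
exists (sc p); first exact: scP.
move=> i; have [le|[q [sq Lq cl]]] := hp i.
  left; apply: le_trans cN; by rewrite ler_pM2r ?invr_gt0 // ler_nat.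
right; exists (sc q); split=> // [|l]; first exact: scP.
apply: le_trans cN; rewrite -mulrBl normrM [`|_^-1|]ger0_norm ?invr_ge0 ?ler0n //.
rewrite ler_pM2r ?invr_gt0 // ler_norml lerBrDr lerBlDr addrC lerBlDl -!natrD.
by rewrite !ler_nat; have [] := cl l; rewrite !(addnC #|I|) => -> ->.
Qed.

(** Label [x] by [i] when [x i <= F x i]. A limit [z] of approximate solutions satisfies this for
    all [i], and equality of the coordinate sums turns it into [F z = z]. *)
Theorem brouwer_simplex (F : (I -> R) -> I -> R) :
  (1 < #|I|)%N -> (forall x, simplex x -> simplex (F x)) ->
  (forall i, filter_continuous_on simplex (F ^~ i)) ->
  exists2 x, simplex x & F x = x.
Proof.
move=> cI FS Fc.
have hL x : simplex x -> exists i, x i <= F x i.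
  move=> xS; apply: contrapT => nx.
  have lt i : F x i < x i by rewrite ltNge; apply/negP => h; apply: nx; exists i.
  have [i0 _] : exists i : I, i \in I by apply/card_gt0P; apply: ltnW.
  have : \sum_i F x i < \sum_i x i.
    rewrite (bigD1 i0) //= [ltRHS](bigD1 i0) //=; apply: ltr_leD => //.
    by apply: ler_sum => i _; apply: ltW.
  by have [_ ->] := FS _ xS; have [_ ->] := xS; rewrite ltxx.
have exa n : exists x, simplex x /\ forall i, x i <= n.+1%:R^-1 \/
    exists y, [/\ simplex y, y i <= F y i & forall l, `|x l - y l| <= n.+1%:R^-1].
  have [|x xS hx] :=
    @simplex_labelling (fun i x => x i <= F x i) n.+1%:R^-1 cI _ hL.
    by rewrite invr_gt0 ltr0n.
  by exists x.
have [a ha] := choice exa.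
have aS n : simplex (a n) by case: (ha n).
(* An ultrafilter finer than [\oo] replaces the extraction of subsequences. *)
have [G [UG oG]] := @ultraFilterLemma nat \oo _.
have PG : ProperFilter G := @ultra_proper _ _ UG.
have FG : Filter G := @filter_filter _ _ PG.
have exz i : exists l : R, a n i @[n --> G] --> l.
  apply: (ultra_compact_cvg UG (@segment_compact R 0 1)).
  apply: nearW => n /=; rewrite in_itv /= simplex_le1 // andbT.
  by case: (aS n).
have [z az] := choice exz.
have z0 i : 0 <= z i by apply: cvg_ge0 (az i) => n; case: (aS n).
have zS : simplex z.
  split=> //; have := cvg_finsum (P := predT) az.
  rewrite (_ : (fun n => _) = cst 1); last first.
    by apply/funext => n; case: (aS n).
  by move=> /(_ _) h; rewrite -(cvg_lim _ h) //; exact: lim_cst.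
have e0 : (fun n => n.+1%:R^-1 : R) n @[n --> G] --> (0 : R).
  by apply: cvg_trans cvg_harmonic => A; apply: oG.
have le i : z i <= F z i.
  have exy n : exists y, [/\ simplex y, a n i <= n.+1%:R^-1 \/ y i <= F y i &
      forall l, `|a n l - y l| <= n.+1%:R^-1].
    have [_ /(_ i) [le|[y [yS Ly cl]]]] := ha n.
      exists (a n); split; [exact: aS|by left|].
      by move=> l; rewrite subrr normr0 invr_ge0.
    by exists y; split; [|right|].
  have [y hy] := choice exy.
  have yz l : y n l @[n --> G] --> z l.
    have d0 : a n l - y n l @[n --> G] --> (0 : R).
      apply/cvgr0Pnorm_lt => e egt0.
      have /cvgr0Pnorm_lt/(_ _ egt0) := e0; apply: filterS => n.
      rewrite ger0_norm ?invr_ge0 //; apply: le_lt_trans.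
      by case: (hy n).
    have := cvgB (FF := FG) (az l) d0; rewrite subr0.
    suff -> : (a ^~ l) - (fun n => a n l - y n l) = y ^~ l by [].
    by apply/funext => n; rewrite !fctE opprB addrC subrK.
  have Fy : F (y n) i @[n --> G] --> F z i.
    by apply: Fc => // n; case: (hy n).
  (* Along [G], either the coordinate [a n i] tends to at most 0, or the neighbour [y n] carries the
     label [i] and its inequality passes to the limit. *)
  have [GA|GA] := in_ultra_setVsetC [set n | a n i <= n.+1%:R^-1] UG.
    apply: (@le_trans _ _ 0); last by case: (FS _ zS).
    have h := cvgB (FF := FG) e0 (az i); rewrite sub0r in h.
    rewrite -oppr_ge0 -(cvg_lim _ h) //; apply: limr_ge.
      by apply/cvg_ex; exists (- z i).
    by apply: filterS GA => n /=; rewrite subr_ge0.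
  have h := cvgB (FF := FG) Fy (yz i).
  rewrite -subr_ge0 -(cvg_lim _ h) //; apply: limr_ge.
    by apply/cvg_ex; exists (F z i - z i).
  apply: filterS GA => n /= nl; rewrite subr_ge0.
  by have [_ [|]] := hy n.
exists z => //; apply/funext => i; apply/eqP; rewrite eq_le le andbT.
rewrite -subr_le0; have : \sum_j (F z j - z j) = 0.
  by rewrite sumrB; have [_ ->] := FS _ zS; have [_ ->] := zS; rewrite subrr.
rewrite (bigD1 i) //= => /eqP; rewrite addr_eq0 => /eqP ->.
by rewrite oppr_le0; apply: sumr_ge0 => j _; rewrite subr_ge0.
Qed.

End Brouwer.

(** * Nash's map on a product of simplices *)

Section NashMap.
Variables (R : realType) (A B : finType).

Definition simplex_prod : set (A * B -> R) :=
  [set z | forall i, simplex (fun j => z (i, j))].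

Let row_sum (y : A * B -> R) i := \sum_j y (i, j).

Let dev (y : A * B -> R) i := `|#|A|%:R^-1 - row_sum y i|.

(** The product of simplices sits in the simplex over [A * B] as the points whose row sums all equal
    [#|A|%:R^-1]. There [dev] vanishes and the map only rescales by [#|A|]; elsewhere adding [dev]
    keeps the denominator positive. *)
Let retract (y : A * B -> R) (p : A * B) :=
  (y p + dev y p.1 / #|B|%:R) / (row_sum y p.1 + dev y p.1).

Hypotheses (cA : (0 < #|A|)%N) (cB : (1 < #|B|)%N).

Let A0 : 0 < #|A|%:R :> R. Proof. by rewrite ltr0n. Qed.
Let B0 : 0 < #|B|%:R :> R. Proof. by rewrite ltr0n ltnW. Qed.

Let den_gt0 y i : 0 < row_sum y i + dev y i.
Proof.
apply: (@lt_le_trans _ _ #|A|%:R^-1); first by rewrite invr_gt0.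
by rewrite -lerBlDl; apply: ler_norm.
Qed.

Let retract_in y : simplex y -> simplex_prod (retract y).
Proof.
move=> [y0 _] i; split=> [j|].
  rewrite /retract /= divr_ge0 ?addr_ge0 ?divr_ge0 ?sumr_ge0 ?normr_ge0 //.
rewrite /retract /= -mulr_suml big_split /= sumr_const -[_ *+ #|_|]mulr_natr.
rewrite divfK ?gt_eqF //.
exact: divff (lt0r_neq0 (den_gt0 _ _)).
Qed.

Let retract_cvg (G : set_system nat) (PG : ProperFilter G)
    (a : nat -> A * B -> R) z : (forall p, a n p @[n --> G] --> z p) ->
  forall p, retract (a n) p @[n --> G] --> retract z p.
Proof.
move=> az [i j]; have FG : Filter G := @filter_filter _ _ PG.
have cs : row_sum (a n) i @[n --> G] --> row_sum z i.
  by apply: cvg_finsum => k; exact: az.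
have cd : dev (a n) i @[n --> G] --> dev z i.
  by apply: cvg_norm; apply: cvgB => //; exact: cvg_cst.
apply: cvgM.
  by apply: cvgD; [exact: az|apply: cvgM => //; exact: cvg_cst].
apply: cvgV; first by rewrite gt_eqF.
exact: cvgD.
Qed.

Variable g : A -> B -> (A * B -> R) -> R.
Hypotheses (g0 : forall i j z, 0 <= g i j z)
  (gc : forall i j, filter_continuous_on simplex_prod (g i j))
  (gz : forall z i, simplex_prod z -> exists j, 0 < z (i, j) /\ g i j z = 0).

(* Nash's map: in a fixed point, either all gains of [i] vanish or every
   [j] in the support of [i] has a positive gain. *)
Lemma nash_map_zero : exists2 z, simplex_prod z & forall i j, g i j z = 0.
Proof.
pose F (y : A * B -> R) (p : A * B) := let z := retract y in
  #|A|%:R^-1 * ((z p + g p.1 p.2 z) / (1 + \sum_l g p.1 l z)).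
have den z i : 0 < 1 + \sum_l g i l z.
  by rewrite ltr_pwDl // sumr_ge0.
have Frow y i : simplex y -> \sum_j F y (i, j) = #|A|%:R^-1.
  move=> yS; rewrite -mulr_sumr /= -mulr_suml big_split /=.
  have [_ ->] := retract_in yS i.
  by rewrite divff ?mulr1 // gt_eqF.
have [|y yS|[i j]|y yS Fy] := @brouwer_simplex R (A * B)%type F.
- rewrite card_prod; apply: leq_trans cB _; exact: leq_pmull.
- split=> [[i j]|].
    rewrite mulr_ge0 ?invr_ge0 //; apply: divr_ge0; last exact: ltW.
    by apply: addr_ge0 => //; case: (retract_in yS i).
  transitivity (\sum_i \sum_j F y (i, j)).
    by rewrite pair_bigA; apply: eq_bigr => -[].
  under eq_bigr do rewrite Frow //.
  by rewrite sumr_const -[_ *+ #|_|]mulr_natr mulVf // gt_eqF.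
- move=> G PG a z zS aS az; have FG : Filter G := @filter_filter _ _ PG.
  have cg k l : g k l (retract (a n)) @[n --> G] --> g k l (retract z).
    apply: gc; first exact: retract_in.
      by move=> n; apply: retract_in.
    exact: retract_cvg.
  apply: cvgM; first exact: cvg_cst.
  apply: cvgM; first by apply: cvgD; [exact: retract_cvg|exact: cg].
  apply: cvgV; first by rewrite gt_eqF.
  by apply: cvgD; [exact: cvg_cst|apply: cvg_finsum => l; exact: cg].
have zS := retract_in yS.
exists (retract y) => // i.
(* All row sums of [F y] are [#|A|%:R^-1], so a fixed point agrees with its retraction up to
   scale. *)
have ysum : row_sum y i = #|A|%:R^-1 by rewrite -(Frow y i yS) Fy.
have zy j : y (i, j) = #|A|%:R^-1 * retract y (i, j).
  rewrite /retract /dev /= ysum subrr normr0 mul0r !addr0 invrK mulrC mulfK //.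
  by rewrite gt_eqF.
have fix_z j : retract y (i, j) * \sum_l g i l (retract y) = g i j (retract y).
  have : #|A|%:R^-1 * retract y (i, j) = F y (i, j) by rewrite Fy -zy.
  rewrite /F /= => /mulfI; rewrite invr_eq0 gt_eqF // => /(_ isT) h.
  have := canRL (divfK (lt0r_neq0 (den _ _))) (esym h).
  by rewrite mulrDr mulr1 => /addrI ->.
(* A supported [j0] with zero gain forces the total gain of [i] to vanish. *)
have [j0 [zj0 gj0]] := gz i zS.
have sum0 : \sum_l g i l (retract y) = 0.
  have := fix_z j0; rewrite gj0 => /eqP; rewrite mulf_eq0 gt_eqF //= => /eqP.
  exact.
by move=> j; rewrite -fix_z sum0 mulr0.
Qed.

End NashMap.

(** * Finite convex combinations *)

Section ConvexCombinations.

(** Only vectors of positive weight are asked to lie in [K], so that the lemma applies to the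
    support of a mixture. *)
Lemma convex_sum (R : realFieldType) (V : lmodType R) (K : set V)
    (B : finType) (x : B -> R) (w : B -> V) :
  (forall u v lam, K u -> K v -> 0 <= lam <= 1 ->
    K (lam *: u + (1 - lam) *: v)) ->
  (forall j, 0 <= x j) -> \sum_j x j = 1 -> (forall j, 0 < x j -> K (w j)) ->
  K (\sum_j x j *: w j).
Proof.
move=> convK x0 x1 wK.
(* Induction on the list of indices, with partial sums normalised by their total weight. *)
suff h s : 0 < \sum_(j <- s) x j ->
    K ((\sum_(j <- s) x j)^-1 *: \sum_(j <- s) x j *: w j).
  by have := h (index_enum B); rewrite x1 invr1 scale1r; apply.
elim: s => [|j s ih]; first by rewrite big_nil ltxx.
rewrite !big_cons; set S := \sum_(j <- s) x j; set W := \sum_(j <- s) _ *: _.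
have S0 : 0 <= S by apply: sumr_ge0.
have [xj0|xj0] := eqVneq (x j) 0; first by rewrite xj0 scale0r !add0r.
have xj : 0 < x j by rewrite lt_def xj0 x0.
have [s0|s0] := eqVneq S 0.
  have -> : W = 0.
    rewrite /W big_seq big1 // => i si.
    suff -> : x i = 0 by rewrite scale0r.
    apply/eqP; rewrite eq_le x0 andbT -s0 /S (big_rem i si) /= lerDl.
    exact: sumr_ge0.
  by move=> _; rewrite s0 !addr0 scalerA mulVf // scale1r; apply: wK.
have S1 : 0 < S by rewrite lt_def s0.
move=> xS; have nz := lt0r_neq0 xS.
have -> : (x j + S)^-1 *: (x j *: w j + W) =
    (x j / (x j + S)) *: w j + (1 - x j / (x j + S)) *: (S^-1 *: W).
  rewrite scalerDr !scalerA (mulrC _ (x j)); congr (_ + _ *: _).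
  by field; rewrite s0.
apply: convK; [exact: wK|exact: ih|].
by rewrite divr_ge0 ?(ltW xS) //= ler_pdivrMr // mul1r lerDl.
Qed.

End ConvexCombinations.

(** * Equilibria against finitely many deviations *)

Section FiniteDeviations.
Variables (R : realType) (n : nat) (mk : 'I_n -> nat) (t0 t1 : R).
Variables (M : 'I_n -> R) (U : forall k : 'I_n, set (ctrl R (mk k))).
Arguments U : clear implicits.
Hypotheses (n0 : (0 < n)%N) (t01 : t0 < t1).
Hypotheses (admU : forall k, admissible t0 t1 (M k) (U k))
           (convU : forall k, convex_C (U k)).

Lemma sup_dist_le p (u v : ctrl R p) e :
  (forall t, t \in `[t0, t1] -> `|u t - v t| <= e) -> sup_dist t0 t1 u v <= e.
Proof.
move=> h; apply: ge_sup.
  by exists `|u t0 - v t0|, t0 => //=; rewrite in_itv /= lexx ltW.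
by move=> _ [t tI <-]; apply: h.
Qed.

Lemma updE (u : ctrl_prof R mk) i : upd u (u i) = u.
Proof.
apply: functional_extensionality_dep => k; rewrite /upd.
by have [<-|ki] := eqVneq i k; rewrite ?dfwithin // dfwithout.
Qed.

Lemma in_prod_upd (u : ctrl_prof R mk) i v :
  in_prod U u -> U i v -> in_prod U (upd (i := i) u v).
Proof.
move=> uU vU k; rewrite /upd.
by have [<-|ki] := eqVneq i k; rewrite ?dfwithin // dfwithout.
Qed.

Definition real_cont_on_prod (H : ctrl_prof R mk -> R) :=
  forall u, in_prod U u -> forall e : R, 0 < e ->
    exists2 del : R, 0 < del &
      forall u', in_prod U u' ->
        (forall k, sup_dist t0 t1 (u' k) (u k) < del) -> `|H u' - H u| < e.

Lemma real_cont_on_prod_cvg H (X : Type) (G : set_system X) {FG : Filter G}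
    (q : X -> ctrl_prof R mk) w :
  real_cont_on_prod H -> in_prod U w -> (\forall x \near G, in_prod U (q x)) ->
  (forall k (e : R), 0 < e -> \forall x \near G,
     forall t, t \in `[t0, t1] -> `|q x k t - w k t| <= e) ->
  H (q x) @[x --> G] --> H w.
Proof.
move=> Hc wU qU qw; apply/cvgrPdist_lt => e e0.
have [del del0 hdel] := Hc w wU e e0.
have h : \forall x \near G, forall k t, t \in `[t0, t1] ->
    `|q x k t - w k t| <= del / 2.
  by apply: filter_forall => k; apply: qw; rewrite divr_gt0.
apply: filterS2 qU h => x xU hx; rewrite distrC; apply: hdel => // k.
apply: (@le_lt_trans _ _ (del / 2)); first exact: sup_dist_le (hx k).
by rewrite ltr_pdivrMr // ltr_pMr // ltr1n.
Qed.

Definition quasiconcave_on (V : lmodType R) (K : set V) (h : V -> R) :=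
  forall x1 x2 c lam, K x1 -> K x2 -> 0 <= lam <= 1 -> c <= h x1 -> c <= h x2 ->
    c <= h (lam *: x1 + (1 - lam) *: x2).

Variable H : 'I_n -> ctrl_prof R mk -> R.
Hypotheses (Hc : forall i, real_cont_on_prod (H i))
  (Hq : forall i u, in_prod U u ->
    quasiconcave_on (U i) (fun v => H i (upd u v))).

Lemma finite_deviations (r : nat) (v : forall k, nat -> ctrl R (mk k)) :
  (forall k j, U k (v k j)) ->
  exists2 u, in_prod U u & forall i j, (j < r)%N -> H i (upd u (v i j)) <= H i u.
Proof.
(* The two extra indices give each player at least two vertices, as [nash_map_zero] requires, even
   when [r] is 0. *)
move=> vU; pose B := 'I_r.+2.
pose mix (z : 'I_n * B -> R) : ctrl_prof R mk :=
  fun k => \sum_(j : B) z (k, j) *: v k j.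
have mixU z : simplex_prod z -> in_prod U (mix z).
  move=> zS k; have [z0 z1] := zS k; apply: convex_sum => //.
  by move=> a b lam aU bU; apply: convU.
(* The common bound [M k] turns convergence of the weights into uniform convergence of the
   mixtures. *)
have mix_cvg (G : set_system nat) (PG : ProperFilter G) a z :
    (forall p, a m p @[m --> G] --> z p) -> forall k (e : R), 0 < e ->
    \forall m \near G, forall t, t \in `[t0, t1] ->
      `|mix (a m) k t - mix z k t| <= e.
  move=> az k e e0; have FG : Filter G := @filter_filter _ _ PG.
  have c0 : \sum_(j : B) `|a m (k, j) - z (k, j)| * M k @[m --> G] -->
      \sum_(j : B) `|z (k, j) - z (k, j)| * M k.
    apply: cvg_finsum => j; apply: cvgM; last exact: cvg_cst.
    by apply: cvg_norm; apply: cvgB => //; exact: cvg_cst.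
  have lim0 : \sum_(j : B) `|z (k, j) - z (k, j)| * M k < e.
    by rewrite big1 // => j _; rewrite subrr normr0 mul0r.
  apply: filterS (cvgr_le _ c0 _ lim0) => m le_e t tI.
  apply: le_trans le_e; rewrite /mix !fct_sumE -sumrB.
  apply: le_trans (ler_norm_sum _ _ _) _; apply: ler_sum => j _.
  rewrite -scalerBl normrZ ler_wpM2l //.
  by have [_ _ _ [_ bM] _] := admU k; apply: bM.
have upd_cvg (G : set_system nat) (PG : ProperFilter G) a z i j :
    (forall p, a m p @[m --> G] --> z p) -> forall k (e : R), 0 < e ->
    \forall m \near G, forall t, t \in `[t0, t1] ->
      `|upd (mix (a m)) (v i j) k t - upd (mix z) (v i j) k t| <= e.
  move=> az k e e0; have := mix_cvg G PG a z az k e e0.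
  apply: filterS => m hm t tI; rewrite /upd; move: hm.
  have [<-|ki] := eqVneq i k; last by rewrite !dfwithout // => /(_ t tI).
  by rewrite !dfwithin subrr normr0 => _; apply: ltW.
pose gain i (j : B) z := H i (upd (mix z) (v i j)) - H i (mix z).
have gain_cont i j : filter_continuous_on (@simplex_prod R 'I_n B) (gain i j).
  move=> G PG a z zS aS az; have FG : Filter G := @filter_filter _ _ PG.
  apply: cvgB; apply: real_cont_on_prod_cvg => //.
  - by apply: in_prod_upd => //; apply: mixU.
  - by apply: nearW => m; apply: in_prod_upd => //; apply: mixU.
  - exact: upd_cvg.
  - exact: mixU.
  - by apply: nearW => m; apply: mixU.
  - exact: mix_cvg.
(* The function used is twice the positive part of [gain]: it is continuous and vanishes exactly
   when the deviation does not pay. *)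
have [||i j z|i j|z i zS|z zS hz] := @nash_map_zero R 'I_n B _ _
    (fun i j z => `|gain i j z| + gain i j z).
- by rewrite card_ord.
- by rewrite card_ord.
- by rewrite -lerBlDr sub0r -normrN ler_norm.
- move=> G PG a z zS aS az; have FG : Filter G := @filter_filter _ _ PG.
  by apply: cvgD; [apply: cvg_norm|]; apply: gain_cont.
(* If every supported control were a strict improvement, the mixture would be one too, because
   strict improvements form a convex set; yet replacing [mix z i] by itself changes nothing. *)
- apply: contrapT => nj.
  have mU := mixU z zS; have [z0 z1] := zS i.
  pose K := [set w | U i w /\ H i (mix z) < H i (upd (mix z) w)].
  suff [_] : K (mix z i) by rewrite updE ltxx.
  apply: convex_sum => // [a b lam [aU ha] [bU hb] lam01|j zj].
    split; first exact: convU.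
    (* Taking the smaller of the two values as level keeps the improvement strict. *)
    have le : Num.min (H i (upd (mix z) a)) (H i (upd (mix z) b)) <=
        H i (upd (mix z) (lam *: a + (1 - lam) *: b)).
      by apply: Hq => //; rewrite ge_min lexx ?orbT.
    by apply: lt_le_trans le; rewrite lt_min ha.
  split=> //; rewrite ltNge; apply/negP => le; apply: nj; exists j; split=> //.
  by rewrite ler0_norm ?addNr // subr_le0.
- exists (mix z); first exact: mixU.
  move=> i j jr; have jr2 : (j < r.+2)%N by rewrite ltnS ltnW // ltnS ltnW.
  have := hz i (Ordinal jr2); rewrite -subr_le0 -/(gain i (Ordinal jr2) z).
  move=> /eqP; rewrite addrC addr_eq0 => /eqP ->.
  by rewrite oppr_le0.
Qed.

End FiniteDeviations.

(** * Compactness of the control sets *)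

Section ControlCompactness.
Variables (R : realType) (t0 t1 : R).
Hypothesis t01 : t0 < t1.

Lemma norm_coord_le (p : nat) (v : 'rV[R]_p) i : `|v ord0 i| <= `|v|.
Proof.
rewrite {2}/Num.norm /= mx_normrE.
exact: (le_bigmax _ (fun ij => `|v ij.1 ij.2|) (ord0, i)).
Qed.

(** Arzela-Ascoli along an ultrafilter: bounds give pointwise limits, equicontinuity makes the
    convergence uniform and the limit continuous, and closedness puts the limit in [U]. *)
Lemma control_ultra_limit (p : nat) (Mk : R) (U : set (ctrl R p))
    (X : Type) (G : set_system X) (UG : UltraFilter G) (g : X -> ctrl R p) :
  admissible t0 t1 Mk U -> (\forall x \near G, U (g x)) ->
  exists2 w, U w & forall e : R, 0 < e -> \forall x \near G,
    forall t, t \in `[t0, t1] -> `|g x t - w t| <= e.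
Proof.
move=> [_ UC Uclosed [Mk0 UM] Ueq] GU.
have PG : ProperFilter G := @ultra_proper _ _ UG.
have FG : Filter G := @filter_filter _ _ PG.
have exw t : exists l : 'rV[R]_p, t \in `[t0, t1] -> g x t @[x --> G] --> l.
  have [tI|_] := boolP (t \in `[t0, t1]); last by exists 0.
  have cK := @rV_compact R p (fun=> `[- Mk, Mk]%classic)
    (fun=> @segment_compact R (- Mk) Mk).
  have [|l hl] := ultra_compact_cvg UG (g := fun x => g x t) cK; last by exists l.
  apply: filterS GU => x Ux i /=; rewrite in_itv /= -ler_norml.
  exact: le_trans (norm_coord_le _ _) (UM _ Ux _ tI).
have [w hw] := choice exw.
have weq t : t \in `[t0, t1] -> forall e : R, 0 < e -> exists2 del : R, 0 < del &
    forall s, s \in `[t0, t1] -> `|s - t| < del ->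
      `|w s - w t| <= e /\ forall u, U u -> `|u s - u t| < e.
  move=> tI e e0; have [del del0 hd] := Ueq t tI e e0.
  exists del => // s sI st; split; last by move=> u Uu; apply: hd.
  have h : `|g x s - g x t| @[x --> G] --> `|w s - w t|.
    by apply: cvg_norm; apply: cvgB; apply: hw.
  rewrite -(cvg_lim _ h) //; apply: limr_le.
    by apply/cvg_ex; exists `|w s - w t|.
  by apply: filterS GU => x Ux; apply: ltW; apply: hd.
have wunif (e : R) : 0 < e -> \forall x \near G,
    forall t, t \in `[t0, t1] -> `|g x t - w t| <= e.
  move=> e0; have e3 : 0 < e / 3 by rewrite divr_gt0.
  (* Compactness in near-covering form makes the [e / 3] estimate around each [t] uniform on the
     whole interval. *)
  have [/(_ (@segment_compact R t0 t1)) nc _] :=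
    compact_near_coveringP (`[t0, t1]%classic : set R).
  pose P x t := t \in `[t0, t1] -> `|g x t - w t| <= e.
  suff h : forall t : R, `[t0, t1]%classic t -> \near t & G, P G t.
    by apply: filterS (nc _ G P FG h) => x hx t tI; apply: hx.
  move=> t /= tI.
  have [del del0 hd] := weq t tI _ e3.
  exists ([set s | `|s - t| < del], [set x | U (g x) /\ `|w t - g x t| < e / 3]).
    split=> /=.
      by apply/nbhs_ballP; exists del => //= s; rewrite /ball /= distrC.
    by apply: filterI => //; apply: (cvgr_dist_lt _ _ (hw t tI)).
  move=> [s x] [/= st [Ux lx]] sI.
  have [ws /(_ _ Ux) gs] := hd s sI st.
  have -> : g x s - w s = (g x s - g x t) - (w t - g x t) - (w s - w t).
    by rewrite !opprB !subrKA.
  apply: le_trans (ler_normB _ _) _; have := ler_normB (g x s - g x t) (w t - g x t).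
  by move: ws gs lx; lra.
have wC : is_Cfun t0 t1 w.
  apply/subspace_continuousP => t tI; apply/cvgrPdist_le => e e0.
  have [del del0 hd] := weq t tI _ e0.
  rewrite near_withinE; apply/nbhs_ballP; exists del => //= s.
  rewrite /ball /= => ts sI; rewrite distrC.
  by have [|le _] := hd s sI; first by rewrite distrC.
exists w => //; apply: contrapT => nUw.
(* Closedness gives a ball about [w] free of [U], yet some [g x] in [U] is within [e / 2] of [w]. *)
have [e e0 he] := Uclosed w wC nUw.
have e2 : 0 < e / 2 by rewrite divr_gt0.
have [x [Ux hx]] := filter_ex (filterI GU (wunif _ e2)).
apply: (he (g x) (UC _ Ux) _ Ux).
apply: le_lt_trans (sup_dist_le t01 hx) _.
by rewrite ltr_pdivrMr // ltr_pMr // ltr1n.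
Qed.

End ControlCompactness.

(** * Scalar Nash equilibria for quasi-concave payoffs *)

Section Nash.
Variables (R : realType) (n : nat) (mk : 'I_n -> nat) (t0 t1 : R).
Variables (M : 'I_n -> R) (U : forall k : 'I_n, set (ctrl R (mk k))).
Arguments U : clear implicits.
Hypotheses (n0 : (0 < n)%N) (t01 : t0 < t1).
Hypotheses (admU : forall k, admissible t0 t1 (M k) (U k))
           (convU : forall k, convex_C (U k)).
Variable H : 'I_n -> ctrl_prof R mk -> R.
Hypotheses (Hc : forall i, real_cont_on_prod t0 t1 U (H i))
  (Hq : forall i u, in_prod U u ->
    quasiconcave_on (U i) (fun v => H i (upd u v))).

Theorem nash_quasiconcave :
  exists2 w, in_prod U w & forall i v, U i v -> H i (upd w v) <= H i w.
Proof.
have u0 k : {u | U k u} by apply: cid; case: (admU k).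
(* An element [s] of [D] lists [s.1] deviations for each player, and [B s] collects the profiles
   that resist them. Concatenating lists makes the sets [B s] a filter base, proper by
   [finite_deviations]. *)
pose D := [set s : nat * (forall k, nat -> ctrl R (mk k)) |
  forall k j, U k (s.2 k j)].
pose B (s : nat * (forall k, nat -> ctrl R (mk k))) := [set u | in_prod U u /\
  forall i j, (j < s.1)%N -> H i (upd u (s.2 i j)) <= H i u].
have FB : Filter (filter_from D B).
  apply: filter_from_filter.
    by exists (0%N, fun k _ => sval (u0 k)) => k j /=; apply: svalP.
  move=> [r v] [r' v'] Dv Dv'.
  exists ((r + r')%N, fun k j => if (j < r)%N then v k j else v' k (j - r)%N).
    by move=> k j /=; case: ifP => _; [apply: Dv|apply: Dv'].
  move=> u [uU /= hu]; split; split=> // i j /= jr.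
    by have := hu i j; rewrite jr; apply; rewrite ltn_addr.
  have := hu i (r + j)%N; rewrite (ltnNge _ r) leq_addr addKn /=; apply.
  by rewrite ltn_add2l.
have PB : ProperFilter (filter_from D B).
  apply: filter_from_proper => -[r v] Dv.
  have [u uU hu] := finite_deviations n0 t01 admU convU Hc Hq r Dv.
  by exists u.
have [G [UG BG]] := ultraFilterLemma PB.
have PG : ProperFilter G := @ultra_proper _ _ UG.
have FG : Filter G := @filter_filter _ _ PG.
have GU : \forall u \near G, in_prod U u.
  apply: BG; exists (0%N, fun k _ => sval (u0 k)); last by move=> u [].
  by move=> k j /=; apply: svalP.
have W k : {w | U k w & forall e : R, 0 < e -> \forall u \near G,
    forall t, t \in `[t0, t1] -> `|u k t - w t| <= e}.
  apply: cid2; apply: (control_ultra_limit t01 UG (g := fun u => u k) (admU k)).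
  by apply: filterS GU.
pose w : ctrl_prof R mk := fun k => s2val (W k).
have wU : in_prod U w by move=> k; apply: (s2valP (W k)).
have wlim k := s2valP' (W k).
exists w => // i v vU.
have c1 : H i (upd u v) @[u --> G] --> H i (upd w v).
  apply: (real_cont_on_prod_cvg t01 (Hc i)); first exact: in_prod_upd.
    by apply: filterS GU => u uU; apply: in_prod_upd.
  move=> k e e0; apply: filterS (wlim k e e0) => u hu t tI.
  rewrite /upd; have [<-|ki] := eqVneq i k.
    by rewrite !dfwithin subrr normr0 ltW.
  by rewrite !dfwithout //; apply: hu.
have c2 : H i u @[u --> G] --> H i w.
  exact: (real_cont_on_prod_cvg t01 (Hc i)).
have h := cvgB (FF := FG) c2 c1.
rewrite -subr_ge0 -(cvg_lim _ h) //; apply: limr_ge.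
  by apply/cvg_ex; eexists; exact: h.
(* A list of length one: [v] for player [i] and a fixed control for every other player. *)
apply: BG; exists (1%N, fun k _ => upd (fun k => sval (u0 k)) v k).
  by move=> k j; apply: in_prod_upd => // k'; apply: svalP.
move=> u [_ /(_ i 0%N isT)] /=; rewrite subr_ge0.
by rewrite {2}/upd dfwithin.
Qed.

End Nash.

(** * Interval order and the larger endpoint *)

Section IntervalOrder.
Variable R : realType.

(** Interiority constrains only the lower endpoint of the difference, which is the minimum of the
    two endpoint differences. *)
Lemma in_int_gH (A B : itv R) :
  in_int_Rplus (gH A B) <-> B.1 < A.1 /\ B.2 < A.2.
Proof.
rewrite /in_int_Rplus /gH /= -!(subr_gt0 (B.1)) -!(subr_gt0 (B.2)).
split=> [h|[h1 h2] r].
  apply/andP; rewrite -lt_min; apply: h.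
  by rewrite lexx le_max ge_min lexx.
by move=> /andP[le _]; apply: lt_le_trans le; rewrite lt_min h1.
Qed.

(** Both endpoint differences lie strictly between [- e] and [e], and a maximum moves no more than
    its arguments. *)
Lemma itv_within_max (e : R) (A B : itv R) : itv_within e A B ->
  `|Num.max A.1 A.2 - Num.max B.1 B.2| < e.
Proof.
move=> h; have /andP[hm _] : - e < (gH A B).1 < e.
  by apply: h; rewrite lexx /= le_max ge_min lexx.
have /andP[_ hM] : - e < (gH A B).2 < e.
  by apply: h; rewrite lexx /= le_max ge_min lexx.
move: hm hM; rewrite /gH /= lt_min gt_max ltr_norml.
move=> /andP[a b] /andP[c d].
by rewrite !maxEle; case: (leP A.1 A.2) => h1; case: (leP B.1 B.2) => h2;
  apply/andP; split; lra.
Qed.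

(* Testing generalized quasi-concavity against degenerate intervals [c, c]. *)
Lemma gen_qconcave_max (V : lmodType R) (K : set V) (F : V -> itv R) :
  gen_qconcave K F -> quasiconcave_on K (fun v => Num.max (F v).1 (F v).2).
Proof.
have nin (c : R) (A : itv R) : ~ in_int_Rplus (gH (c, c) A) <-> c <= Num.max A.1 A.2.
  rewrite leNgt gt_max; split=> [h|/negP h hin]; last first.
    by apply: h; apply/andP; have [+ _] := in_int_gH (c, c) A; exact.
  by apply/negP => /andP lt; apply: h; apply/in_int_gH.
move=> h x1 x2 c lam K1 K2 lam01 /nin c1 /nin c2; apply/nin.
exact: (h x1 x2 (c, c) lam K1 K2 (lexx c) lam01 c1 c2).
Qed.

End IntervalOrder.

(** * Pareto-Nash equilibria of the interval game *)

Unset Implicit Arguments.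

Theorem theorem3p2 (R : realType) (n m : nat) (mk : 'I_n -> nat)
    (t0 t1 : R) (x0 : 'rV[R]_m)
    (M : 'I_n -> R) (U : forall k : 'I_n, set (ctrl R (mk k)))
    (f : R -> 'rV[R]_m -> ctrl_val R mk -> 'rV[R]_m)
    (d : 'I_n -> nat)
    (psi : forall i : 'I_n, 'rV[R]_m -> itv_vec R (d i))
    (L : forall i : 'I_n, R -> 'rV[R]_m -> ctrl_val R mk -> itv_vec R (d i)) :
  (0 < n)%N ->
  0 <= t0 -> t0 < t1 ->
  (forall k, admissible t0 t1 (M k) (U k)) ->
  (forall k, convex_C (U k)) ->
  in_Y t0 t1 M f ->
  (forall i x j, is_itv (psi i x j)) ->
  (forall i t x w j, t0 <= t <= t1 -> is_itv (L i t x w j)) ->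
  (forall i : 'I_n, exists ki : 'I_(d i),
     itv_cont_on_prod t0 t1 U
       (fun u => payoff t0 t1 x0 f (psi i) (L i) u ki) /\
     (forall u, in_prod U u ->
        gen_qconcave (U i)
          (fun v => payoff t0 t1 x0 f (psi i) (L i) (upd u v) ki))) ->
  exists2 ustar : ctrl_prof R mk, in_prod U ustar &
    forall (i : 'I_n) (v : ctrl R (mk i)), U i v ->
      ~ itv_prec (payoff t0 t1 x0 f (psi i) (L i) ustar)
                 (payoff t0 t1 x0 f (psi i) (L i) (upd ustar v)).
Proof.
move=> n0 _ t01 admU convU _ _ _ hyp.
pose J i u ki := payoff t0 t1 x0 f (psi i) (L i) u ki.
pose ki i := sval (cid (hyp i)).
have [Jc Jq] : (forall i, itv_cont_on_prod t0 t1 U (fun u => J i u (ki i))) /\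
    forall i u, in_prod U u -> gen_qconcave (U i) (fun v => J i (upd u v) (ki i)).
  by split=> i; case: (svalP (cid (hyp i))).
pose H i u := Num.max (J i u (ki i)).1 (J i u (ki i)).2.
have [i u uU e e0|i u uU|u uU hu] :=
    @nash_quasiconcave R n mk t0 t1 M U n0 t01 admU convU H.
- have [del del0 hdel] := Jc i u uU e e0; exists del => // u' u'U hu'.
  exact/itv_within_max/hdel.
- exact: gen_qconcave_max (Jq i u uU).
(* Strict precedence would raise both endpoints of component [ki i], hence their maximum [H i]. *)
exists u => // i v vU /(_ (ki i)) /in_int_gH [lt1 lt2].
have := hu i v vU; rewrite /H leNgt => /negP; apply.
by rewrite gt_max !lt_max lt1 lt2 orbT.
Qed.
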